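(* Let $S$ be a numerical semigroup, let $n\in S\setminus\{0\}$, and write $\operatorname{Ap}(S,n)=\{0=\omega(0),\omega(1),\dots,\omega(n-1)\}$, where $\omega(i)$ is the least element of $S$ congruent to $i$ modulo $n$. If $a\in\mathbb{N}\setminus S$, then $$\operatorname{Ap}\left(\frac{S}{a},n\right)=\{0,\ n\kappa_1+1,\ n\kappa_2+2,\ \dots,\ n\kappa_{n-1}+n-1\},$$ where $$\kappa_i=\left\lceil\frac{\omega(ai\bmod n)-a\,i}{a\,n}\right\rceil,\qquad i=1,\dots,n-1.$$
   Context: $\mathbb{N}$ is the set of non-negative integers. A numerical semigroup is a subset $S\subseteq\mathbb{N}$ containing $0$, closed under addition, with $\mathbb{N}\setminus S$ finite. For a positive integer $d$, the quotient of $S$ by $d$ is the numerical semigroup $\frac{S}{d}=\{x\in\mathbb{N}\mid dx\in S\}$. For $n\in S\setminus\{0\}$, the Apéry set of $S$ with respect to $n$ is $\operatorname{Ap}(S,n)=\{x\in S\mid x-n\notin S\}$; it equals $\{\omega(0),\dots,\omega(n-1)\}$ where $\omega(i)$ is the least element of $S$ congruent to $i$ modulo $n$. $(u\bmod n)$ denotes the remainder of the Euclidean division of $u$ by $n$, and $\lceil r\rceil$ is the least integer greater than or equal to the rational number $r$. *)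

(* Defs.v *)
From mathcomp Require Import all_boot all_order all_algebra.
From mathcomp Require Import boolp classical_sets functions cardinality.

Set Implicit Arguments.
Unset Strict Implicit.
Unset Printing Implicit Defensive.

Local Open Scope classical_set_scope.

Definition numerical_semigroup (S : set nat) : Prop :=
  [/\ S 0, forall x y, S x -> S y -> S (x + y) & finite_set (~` S)].

Definition quotient (S : set nat) (d : nat) : set nat := [set x | S (d * x)].

(* The difference x - n in "x - n is not in S" is the integer one; since S
   consists of naturals, x - n is in S iff n <= x and the truncated difference
   is in S. *)
Definition apery (S : set nat) (n : nat) : set nat :=
  [set x | S x /\ ~ (n <= x /\ S (x - n))].

Definition is_least (A : set nat) (m : nat) : Prop := A m /\ lbound A m.

(* The default value 0 is never used when S is a numerical semigroup and
   0 < n: see omegaP. *)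
Definition omega (S : set nat) (n i : nat) : nat :=
  xget 0 (is_least [set x | S x /\ x = i %[mod n]]).

Lemma omegaP (S : set nat) (n i : nat) :
  numerical_semigroup S -> 0 < n ->
  is_least [set x | S x /\ x = i %[mod n]] (omega S n i).
Proof.
move=> [_ _ finC] n_gt0; rewrite /omega; apply: xgetPex.
set A := [set x | _].
have [x Ax] : exists x, A x.
  apply: contrapT => noA; apply: infinite_nat.
  pose f k := i + k * n.
  have finj : {in [set: nat] &, injective f}.
    by move=> j k _ _ /eqP; rewrite /f eqn_add2l eqn_pmul2r // => /eqP.
  rewrite -(eq_finite_set (inj_card_eq finj)).
  apply: sub_finite_set finC => _ [k _ <-] Sfk; apply: noA.
  by exists (f k); split; [ | rewrite /f addnC modnMDl].
have exA : exists k, `[< A k >] by exists x; apply/asboolP.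
case: (ex_minnP exA) => m /asboolP Am minm.
by exists m; split=> // y Ay; apply: minm; apply/asboolP.
Qed.

Local Open Scope ring_scope.

Definition kappa (S : set nat) (n a i : nat) : int :=
  Num.ceil ((((omega S n ((a * i) %% n)%N)%:Z - (a * i)%:Z)%:Q
             / ((a * n)%:Z)%:Q) : rat).

(* Main.v *)
(* Since n is in S, a natural number s lies in S exactly when omega(s mod n) <= s.
   Applied to s = a(nk + i), this says that nk + i lies in S/a exactly when
   k >= kappa_i; hence the elements of Ap(S/a, n) are the n kappa_i + i with
   0 <= i < n, and kappa_0 = 0. *)
Require Import Defs.
From mathcomp Require Import all_boot all_order all_algebra.
From mathcomp Require Import classical_sets functions cardinality.
From mathcomp Require Import zify.
Import Order.TTheory GRing.Theory Num.Theory.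

Local Open Scope classical_set_scope.
Local Open Scope ring_scope.

Lemma numerical_semigroup_mul (S : set nat) (n q : nat) :
  numerical_semigroup S -> S n -> S (q * n)%N.
Proof.
move=> [S0 SD _] Sn; elim: q => [|q IHq]; first by rewrite mul0n.
by rewrite mulSn; apply: SD.
Qed.

(** [s] and [omega S n (s %% n)] are congruent modulo [n], so if [s] is the larger it is reached by
    adding a multiple of [n], which lies in [S]; the converse is minimality. *)
Lemma mem_omega_le (S : set nat) (n s : nat) :
  numerical_semigroup S -> S n -> (0 < n)%N ->
  S s <-> (omega S n (s %% n) <= s)%N.
Proof.
move=> HS Sn n_gt0; have [[/= So oE] omin] := omegaP (s %% n) HS n_gt0.
split=> [Ss | les]; first by apply: omin; rewrite /= modn_mod.
have dvd_n : (n %| s - omega S n (s %% n))%N.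
  by rewrite -eqn_mod_dvd // oE modn_mod.
rewrite -(subnKC les) -(divnK dvd_n).
by case: (HS) => _ SD _; apply: SD => //; apply: numerical_semigroup_mul.
Qed.

(** As a(nk + i) is congruent to ai modulo n, membership reads omega(ai mod n) <= a(nk + i);
    dividing by an > 0 bounds the fraction under the ceiling by the integer k. *)
Lemma kappa_le (S : set nat) (n a i k : nat) :
  numerical_semigroup S -> S n -> (0 < n)%N -> (0 < a)%N ->
  kappa S n a i <= k%:Z <-> quotient S a (n * k + i)%N.
Proof.
move=> HS Sn n_gt0 a_gt0.
rewrite /quotient /= (mem_omega_le S n) // mulnDr mulnCA mulnC modnMDl.
rewrite /kappa ceil_le_int ler_pdivrMr ?ltr0z ?ltz_nat ?muln_gt0 ?a_gt0 //.
rewrite -intrM ler_int lerBlDr -PoszM -PoszD lez_nat.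
by rewrite [(k * _)%N]mulnCA [(a * _)%N]mulnC mulnA.
Qed.

(** Since omega >= 0 and ai < an, the fraction exceeds -1. *)
Lemma kappa_ge0 (S : set nat) (n a i : nat) : (i < n)%N -> (0 < a)%N ->
  0 <= kappa S n a i.
Proof.
move=> i_lt_n a_gt0; have n_gt0 : (0 < n)%N by apply: leq_ltn_trans i_lt_n.
rewrite /kappa ceil_ge0 ltr_pdivlMr ?ltr0z ?ltz_nat ?muln_gt0 ?a_gt0 //.
rewrite mulN1r -intrN ltr_int.
have : (a * i < a * n)%N by rewrite ltn_pmul2l.
lia.
Qed.

Lemma kappa0 (S : set nat) (n a : nat) :
  numerical_semigroup S -> S n -> (0 < n)%N -> (0 < a)%N -> kappa S n a 0 = 0.
Proof.
move=> HS Sn n_gt0 a_gt0; apply/le_anti/andP; split; last exact: kappa_ge0.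
by apply/kappa_le => //; rewrite /quotient /= muln0 addn0 muln0; case: HS.
Qed.

(** By [kappa_le] at k and k - 1, the Apery condition says kappa_i <= k but not kappa_i <= k - 1. *)
Lemma apery_quotientE (S : set nat) (n a i k : nat) :
  numerical_semigroup S -> S n -> (0 < a)%N -> (i < n)%N ->
  apery (quotient S a) n (n * k + i)%N <-> kappa S n a i = k%:Z.
Proof.
move=> HS Sn a_gt0 i_lt_n.
have n_gt0 : (0 < n)%N by apply: leq_ltn_trans i_lt_n.
have kle j := kappa_le S n a i j HS Sn n_gt0 a_gt0.
have k_ge0 := kappa_ge0 S n a i i_lt_n a_gt0.
rewrite /apery /= -kle; case: k => [|k].
  (* For k = 0 the number i - n is negative, and kappa_i >= 0 supplies the lower bound. *)
  rewrite muln0 add0n leqNgt i_lt_n; split=> [[k_le0 _] | ->]; first lia.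
  by split=> // -[].
rewrite mulnS -addnA addKn leq_addr -kle.
split=> [[k_le not_le] | ->]; last by split; [|case]; lia.
have /negP : ~ kappa S n a i <= k%:Z by move=> k_ge; apply: not_le.
lia.
Qed.

(* Both sides are sets of integers, since kappa is integer-valued. *)
Theorem theorem14 (S : set nat) (n a : nat) :
  numerical_semigroup S -> S n -> n <> 0%N -> ~ S a ->
  [set x%:Z | x in apery (quotient S a) n] =
  [set 0 : int] `|`
  [set n%:Z * kappa S n a i + i%:Z | i in [set i : nat | (1 <= i < n)%N]].
Proof.
move=> HS Sn /eqP; rewrite -lt0n => n_gt0 nSa.
have a_gt0 : (0 < a)%N by case: posnP nSa => // ->; case: HS.
(* Being nonnegative, kappa_i is itself a valid natural k. *)
have mem_apery i : (i < n)%N -> exists2 k : nat,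
    kappa S n a i = k%:Z & apery (quotient S a) n (n * k + i)%N.
  move=> i_lt_n; have /gez0_abs kE := kappa_ge0 S n a i i_lt_n a_gt0.
  by exists `|kappa S n a i|%N; last apply/apery_quotientE.
apply/seteqP; split=> [_ [x Ax <-] | z [-> | [i /= /andP[_ i_lt_n] <-]]] /=.
- have i_lt_n : (x %% n < n)%N by rewrite ltn_mod.
  move: Ax; rewrite {1}(divn_eq x n) mulnC => /apery_quotientE kE.
  have {}kE := kE HS Sn a_gt0 i_lt_n.
  (* Residue 0 is listed apart: there kappa_0 = 0 forces the quotient [x %/ n] to vanish, so x =
     0. *)
  have [i0 | i_gt0] := posnP (x %% n).
    left; move: kE; rewrite i0 kappa0 // => -[q0].
    by rewrite (divn_eq x n) i0 -q0 mul0n.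
  right; exists (x %% n)%N; first by rewrite /= i_gt0.
  by rewrite kE -PoszM -PoszD mulnC -divn_eq.
- have [k] := mem_apery 0 n_gt0; rewrite kappa0 // => -[<-].
  by rewrite muln0 => A0; exists 0%N.
- have [k -> Ak] := mem_apery i i_lt_n.
  by exists (n * k + i)%N => //; rewrite PoszD PoszM.
Qed.
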